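(* There exist an absolute constant $C>0$ and infinitely many positive integers $n$ such that for each such $n$ there is an undirected, unweighted graph $G$ on $n$ vertices with maximum degree $3$ for which every hub labeling $\{S_v\}_{v\in V(G)}$ of $G$ satisfies $$\frac{1}{n}\sum_{v\in V(G)}|S_v|\;\ge\;\frac{n}{2^{C\sqrt{\log n}}}.$$
   Context: For an undirected unweighted graph $G=(V,E)$, a hub labeling is a family of sets $S_v\subseteq V$, $v\in V$, such that for every pair $u,v\in V$ at finite distance there is a vertex $w\in S_u\cap S_v$ lying on some shortest $u$–$v$ path, i.e. $\mathrm{dist}(u,w)+\mathrm{dist}(w,v)=\mathrm{dist}(u,v)$. Its average size is $\frac1n\sum_v|S_v|$. *)

(* Defs.v *)
From mathcomp Require Import all_boot.
Set Implicit Arguments. Unset Strict Implicit. Unset Printing Implicit Defensive.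

Definition simple_graph (n : nat) (e : rel 'I_n) : Prop :=
  (forall u v, e u v = e v u) /\ (forall v, ~~ e v v).

Definition degree (n : nat) (e : rel 'I_n) (v : 'I_n) : nat :=
  #|[set w | e v w]|.

Definition max_degree3 (n : nat) (e : rel 'I_n) : Prop :=
  (forall v, degree e v <= 3) /\ (exists v, degree e v = 3).

Fixpoint walk (n : nat) (e : rel 'I_n) (k : nat) (u v : 'I_n) : bool :=
  match k with
  | 0 => u == v
  | k'.+1 => [exists w, e u w && walk e k' w v]
  end.

Definition is_dist (n : nat) (e : rel 'I_n) (u v : 'I_n) (d : nat) : Prop :=
  walk e d u v /\ (forall k, k < d -> ~~ walk e k u v).

Definition hub_labeling (n : nat) (e : rel 'I_n) (S : 'I_n -> {set 'I_n}) : Prop :=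
  forall u v d, is_dist e u v d ->
    exists w, [/\ w \in S u, w \in S v &
      exists d1 d2, [/\ is_dist e u w d1, is_dist e w v d2 & d1 + d2 = d]].

Definition total_size (n : nat) (S : 'I_n -> {set 'I_n}) : nat :=
  \sum_(v < n) #|S v|.

(* Main.v *)
Require Import Defs.
From mathcomp Require Import all_boot zify.

(** Consider the layered weighted graph with levels 0, ..., 2c, each a copy of
    [0, s)^c, in which an edge from level i to level i + 1 changes only the
    coordinate i mod c and costs K + 2 d^2 when it changes by d.  By strict
    convexity, between points x of level 0 and z of level 2c with even
    coordinates every shortest path changes each coordinate by half of the
    difference both times.  Hence a point on such a path at a level > c
    determines z from x, and one at a level <= c determines x from z, so
    assigning to (x, z) a common hub, charged to x or to z accordingly, is
    injective, and the total hub size is at least the number of pairs (x, z).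
    Every point is expanded into a path carrying one port per incident edge,
    and edges are subdivided, giving maximum degree 3.  With s ~ 2^c the graph
    has 2^(c^2 + O(c)) vertices, and there are 2^(2c^2) pairs.  Distances are
    bounded below by explicit 1-Lipschitz potentials. *)

Set Implicit Arguments. Unset Strict Implicit. Unset Printing Implicit Defensive.

(** * Walks and distances *)

Section Walks.
Variables (n : nat) (e : rel 'I_n).

Lemma walk_cat a b u v w : walk e a u v -> walk e b v w -> walk e (a + b) u w.
Proof.
elim: a u => [|a IH] u /=; first by move/eqP->.
case/existsP=> t /andP[ut tv] vw; apply/existsP; exists t.
by rewrite ut IH.
Qed.

(** All lower bounds on walk lengths come from here, with [f] an explicit potential. *)
Lemma walk_lipschitz (f : 'I_n -> nat) k u v :
  (forall u v, e u v -> f v <= (f u).+1 /\ f u <= (f v).+1) -> walk e k u v ->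
  f v <= f u + k /\ f u <= f v + k.
Proof.
move=> fL; elim: k u => [|k IH] u /=; first by move/eqP->; rewrite addn0.
by case/existsP=> t /andP[/fL ut /IH tv]; lia.
Qed.

Lemma walk_dist k u v : walk e k u v -> exists2 d, is_dist e u v d & d <= k.
Proof.
move=> uv; have uvE : exists k, walk e k u v by exists k.
case: (ex_minnP uvE) => d uvd dmin; exists d; last exact: dmin.
by split=> // j; rewrite ltnNge; apply: contra; apply: dmin.
Qed.

End Walks.

Lemma total_size_card n (S : 'I_n -> {set 'I_n}) : total_size S = #|[set p | p.2 \in S p.1]|.
Proof.
rewrite /total_size -sum1_card (eq_bigr (fun v => \sum_(w in S v) 1)); last by move=> v _; rewrite sum1_card.
by rewrite pair_big_dep /=; apply: eq_bigl => p; rewrite inE.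
Qed.

(** * Subdivision of weighted edges, degrees, and extension of potentials *)

Section Subdivision.
Variables (U : finType) (nxt : rel U) (port : pred U) (tgt : U -> U).
Variables (len : U -> nat) (M : nat).
Hypothesis len_gt1 : forall u, 1 < len u.
Hypothesis len_le : forall u, len u <= M.

(* Vertex (u, 0) is u itself; (u, k) with 0 < k < len u is the k-th inner point
   of the path of length len u from u to tgt u.  The other pairs are isolated. *)
Definition arc (x y : U * 'I_M) : bool :=
  [|| [&& nxt x.1 y.1, x.2 == 0 :> nat & y.2 == 0 :> nat],
      [&& port x.1, y.1 == x.1, y.2 == x.2.+1 :> nat & y.2 < len x.1]
    | [&& port x.1, y.1 == tgt x.1, x.2.+1 == len x.1 & y.2 == 0 :> nat]].

Definition sdg : rel 'I_#|{: U * 'I_M}| :=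
  fun p q => arc (enum_val p) (enum_val q) || arc (enum_val q) (enum_val p).

Lemma sdg_simple : irreflexive nxt -> simple_graph sdg.
Proof.
move=> nxtI; split=> [p q|p]; first exact: orbC.
rewrite /sdg orbb; case: (enum_val p) => u k; rewrite /arc /= nxtI /=.
by move: (len_gt1 u) => H; lia.
Qed.

Hypothesis nxt_fun : forall u v w, nxt u v -> nxt u w -> v = w.
Hypothesis nxt_inj : forall u v w, nxt v u -> nxt w u -> v = w.
Hypothesis tgt_inj : {in port &, injective tgt}.
Hypothesis tgt_port : forall u, port u -> ~~ port (tgt u).

Lemma arcP u k v a : arc (u, k) (v, a) ->
  [\/ [/\ nxt u v, k = 0 :> nat & a = 0 :> nat],
      [/\ port u, v = u, a = k.+1 :> nat & k.+1 < len u]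
    | [/\ port u, v = tgt u, k.+1 = len u & a = 0 :> nat]].
Proof.
rewrite /arc /=; case/or3P=> [/and3P[uv /eqP k0 /eqP a0]|/and4P[pu /eqP-> /eqP a1 lt]
  |/and4P[pu /eqP-> /eqP lk /eqP a0]]; [exact: Or31 | | exact: Or33].
by apply: Or32; split=> //; rewrite -a1.
Qed.

(** A vertex [(u, 0)] has at most one [nxt]-predecessor, one [nxt]-successor and one subdivided
    edge, which starts at [u] if [u] is a port and ends there otherwise. An inner point has one arc
    in and one out. *)
Lemma arc_degree x : #|[set y | arc x y || arc y x]| <= 3.
Proof.
case: x => u k.
have sub1 (P : pred (U * 'I_M)) :
    (forall v a w b, P (v, a) -> P (w, b) -> v = w /\ a = b :> nat) -> #|[set y | P y]| <= 1.
  move=> PE; apply/card_le1_eqP => -[v a] [w b]; rewrite !inE => Pv Pw.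
  by have [-> /val_inj->] := PE _ _ _ _ Pw Pv.
have [k0|k_gt0] := posnP k.
  pose A := [set y : U * 'I_M | nxt u y.1 && (y.2 == 0 :> nat)].
  pose B := [set y : U * 'I_M | nxt y.1 u && (y.2 == 0 :> nat)].
  pose H (y : U * 'I_M) := if port u then (y.1 == u) && (y.2 == 1 :> nat)
    else [&& port y.1, tgt y.1 == u & y.2.+1 == len y.1].
  have sub : [set y | arc (u, k) y || arc y (u, k)] \subset A :|: B :|: [set y | H y].
    apply/subsetP => -[v a]; rewrite !inE /H /=.
    case/orP=> /arcP[[uv k1 a1]|[pu -> a1 _]|[pu E lk a0]].
    - by rewrite uv a1.
    - by rewrite a1 k0 pu !eqxx !orbT.
    - by have := len_gt1 u; rewrite -lk k0.
    - by rewrite uv k1 orbT.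
    - by move: k0; rewrite a1.
    - have nu : port u = false by rewrite E; apply/negbTE/tgt_port.
      by rewrite nu pu -E lk !eqxx !orbT.
  apply: leq_trans (subset_leq_card sub) _.
  rewrite -[3]/(1 + 1 + 1); apply: leq_trans (leq_card_setU _ _) _.
  apply: leq_add; first apply: leq_trans (leq_card_setU _ _) _; first apply: leq_add.
  - by apply: sub1 => v a w b /= /andP[uv /eqP->] /andP[/(nxt_fun uv)-> /eqP->].
  - by apply: sub1 => v a w b /= /andP[uv /eqP->] /andP[/(nxt_inj uv)-> /eqP->].
  - apply: sub1 => v a w b; rewrite /H /=; case: ifP => _.
      by move=> /andP[/eqP-> /eqP->] /andP[/eqP-> /eqP->].
    move=> /and3P[pv /eqP vu /eqP a1] /and3P[pw /eqP wu /eqP b1].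
    have E : v = w by apply: tgt_inj; rewrite // vu.
    by split=> //; apply: succn_inj; rewrite a1 b1 E.
have -> : [set y | arc (u, k) y || arc y (u, k)] = [set y | arc (u, k) y] :|: [set y | arc y (u, k)].
  by apply/setP=> y; rewrite !inE.
apply: leq_trans (leq_card_setU _ _) _; apply: (@leq_trans (1 + 1)) => //.
apply: leq_add; apply: sub1 => v a w b.
  move=> /arcP[[_ E _]|[_ -> -> lt]|[_ -> lt ->]]; first by rewrite E in k_gt0.
    by move=> /arcP[[_ E _]|[_ -> -> _]|[_ _ E _]]; rewrite ?E in k_gt0 lt * => //; lia.
  by move=> /arcP[[_ E _]|[_ _ _ E]|[_ -> _ ->]] //; rewrite ?E in k_gt0 *; lia.
move=> /arcP[[_ _ E]|[_ -> E _]|[_ _ _ E]]; try by rewrite E in k_gt0.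
move=> /arcP[[_ _ E']|[_ -> E' _]|[_ _ _ E']]; try by rewrite E' in k_gt0.
by split=> //; apply: succn_inj; rewrite -E.
Qed.

Lemma sdg_degree p : degree sdg p <= 3.
Proof.
apply: leq_trans (arc_degree (enum_val p)); rewrite /degree.
rewrite -(card_imset _ enum_val_inj); apply/subset_leq_card/subsetP=> y.
by case/imsetP=> q; rewrite !inE => pq ->.
Qed.

Lemma sdg_degree3 u v w (k0 k1 : 'I_M) : k0 = 0 :> nat -> k1 = 1 :> nat ->
  irreflexive nxt -> nxt v u -> nxt u w -> v != w -> port u -> 2 < len u ->
  exists p, degree sdg p = 3.
Proof.
move=> k00 k11 nxtI vu uw vw pu lu; exists (enum_rank (u, k0)); apply/eqP.
rewrite eqn_leq sdg_degree /=.
have ne : k0 != k1 by apply/eqP=> /(congr1 val); rewrite /= k00 k11.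
pose s := [:: (v, k0); (w, k0); (u, k1)].
have s_uniq : uniq s by rewrite /= !inE !xpair_eqE (negbTE vw) (negbTE ne) !andbF.
rewrite -[3]/(size (map enum_rank s)) -(card_uniqP _).
  apply: subset_leq_card; apply/subsetP=> q /mapP[y ys ->].
  rewrite inE /sdg !enum_rankK; move: ys; rewrite !inE => /or3P[]/eqP->.
  - by rewrite /arc /= vu k00 !eqxx !orbT.
  - by rewrite /arc /= uw k00 !eqxx.
  - by rewrite /arc /= pu k00 k11 !eqxx (ltnW lu) !orbT.
by rewrite map_inj_uniq //; exact: enum_rank_inj.
Qed.

Lemma walk_arc x y : arc x y -> walk sdg 1 (enum_rank x) (enum_rank y).
Proof. by move=> xy; apply/existsP; exists (enum_rank y); rewrite /sdg !enum_rankK xy /=. Qed.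

Lemma walk_hair u (k0 : 'I_M) : k0 = 0 :> nat -> port u ->
  walk sdg (len u) (enum_rank (u, k0)) (enum_rank (tgt u, k0)).
Proof.
move=> k00 pu.
have inner d (a : 'I_M) : a = d :> nat -> d < len u -> walk sdg d (enum_rank (u, k0)) (enum_rank (u, a)).
  elim: d a => [|d IH] a ad lt.
    by have -> : a = k0; [apply: val_inj; rewrite /= ad k00 | apply: eqxx].
  have dM : d < M by rewrite ltnW // -ad.
  rewrite -addn1; apply: walk_cat (IH (Ordinal dM) _ (ltnW lt)) _ => //.
  by apply: walk_arc; rewrite /arc /= pu ad lt !eqxx !orbT.
case lenE: (len u) (len_gt1 u) (len_le u) => [|d] // _ dM; rewrite -addn1.
apply: walk_cat (inner d (Ordinal dM) _ _) _ => //; first by rewrite lenE.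
by apply: walk_arc; rewrite /arc /= pu k00 lenE !eqxx !orbT.
Qed.

Section Potential.
Variable f : U -> nat.
Hypothesis f_nxt : forall u v, nxt u v -> f v <= (f u).+1 /\ f u <= (f v).+1.
Hypothesis f_tgt : forall u, port u -> f (tgt u) <= f u + len u /\ f u <= f (tgt u) + len u.

(** The greatest 1-Lipschitz extension of [f] from the two ends to a subdivided edge. Off these
    edges only the value at [x.2 = 0] matters. *)
Definition spread (x : U * 'I_M) : nat :=
  if port x.1 && (x.2 < len x.1) then minn (f x.1 + x.2) (f (tgt x.1) + (len x.1 - x.2))
  else f x.1 + x.2.

Lemma spread0 u (k : 'I_M) : k = 0 :> nat -> spread (u, k) = f u.
Proof.
rewrite /spread /= => ->; rewrite addn0 subn0.
by case: ifP => // /andP[/f_tgt[_ le] _]; apply/minn_idPl.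
Qed.

Lemma spread_arc x y : arc x y -> spread y <= (spread x).+1 /\ spread x <= (spread y).+1.
Proof.
case: x y => [u k] [v a] /arcP[[uv k0 a0]|[pu -> a1 lt]|[pu E lk a0]].
- by rewrite !spread0 //; apply: f_nxt.
- rewrite /spread /= pu a1 lt (ltnW lt) /=; lia.
- rewrite (spread0 _ a0) E /spread /= pu -lk ltnSn /=.
  by have := f_tgt pu; rewrite -lk; lia.
Qed.

Lemma sdg_lipschitz p q d : walk sdg d p q ->
  spread (enum_val q) <= spread (enum_val p) + d /\ spread (enum_val p) <= spread (enum_val q) + d.
Proof.
apply: (@walk_lipschitz _ _ (spread \o enum_val)) => u v /orP[]/spread_arc /= [] //.
Qed.

End Potential.

(* Only when both spreads come from the far end of the subdivided edge does
   tightness at x not pass to x.1, and then the sum exceeds D at the far end. *)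
Lemma spread_tight (f g : U -> nat) D x :
  (forall u, port u -> f u <= f (tgt u) + len u /\ g u <= g (tgt u) + len u) ->
  (forall u, D <= f u + g u) ->
  spread f x + spread g x <= D -> f x.1 + g x.1 <= D.
Proof.
move=> fg lb; rewrite /spread; case: ifP => [/andP[/fg]|_]; last by lia.
by have := lb (tgt x.1); lia.
Qed.

End Subdivision.

(** * Quadratic cost of moving one coordinate *)

Section Costs.
Variable s : nat.

Definition sq (a b : nat) : nat := (a - b + (b - a)) ^ 2.

Lemma sqE a b : sq a b + 2 * (a * b) = a * a + b * b.
Proof. by rewrite /sq -mulnn; case: (leqP a b) => /subnKC <-; nia. Qed.

Lemma sqC a b : sq a b = sq b a.
Proof. by rewrite /sq addnC. Qed.

Lemma sq_eq0 a b : sq a b = 0 -> a = b.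
Proof. by rewrite /sq => /eqP; rewrite expn_eq0 /= => /eqP; lia. Qed.

Lemma sq_lt a b : a < s -> b < s -> sq a b < s * s.
Proof. by move=> las lbs; rewrite /sq -mulnn; apply: ltn_mul; lia. Qed.

Lemma sq_double a b : sq (2 * a) (2 * b) = 4 * sq a b.
Proof. by move: (sqE (2 * a) (2 * b)) (sqE a b); nia. Qed.

Lemma sq_double_mid a b : sq (2 * a) (a + b) = sq a b.
Proof. by move: (sqE (2 * a) (a + b)) (sqE a b); nia. Qed.

Lemma sq_mid_double a b : sq (a + b) (2 * b) = sq a b.
Proof. by rewrite addnC sqC sq_double_mid sqC. Qed.

(** Strict convexity in exact form: the excess over [sq x z] is a square that vanishes only when [w]
    is the midpoint. *)
Lemma sq_parallelogram x w z : 2 * sq x w + 2 * sq w z = sq x z + sq (x + z) (2 * w).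
Proof. by move: (sqE x w) (sqE w z) (sqE x z) (sqE (x + z) (2 * w)); nia. Qed.

(* Lower bound on the price of moving from a to b with at most m changes; the
   penalty for a forbidden move dominates every admissible cost. *)
Definition cost (m a b : nat) : nat :=
  match m with
  | 0 => (a != b) * (2 * (s * s))
  | 1 => 2 * sq a b
  | _ => sq a b
  end.

Lemma costC m a b : cost m a b = cost m b a.
Proof. by case: m => [|[|m]] /=; rewrite ?(sqC a b) // eq_sym. Qed.

Lemma costxx m a : cost m a a = 0.
Proof. by case: m => [|[|m]] /=; rewrite ?eqxx /sq ?subnn. Qed.

Lemma cost_step m x a b : x < s -> a < s -> b < s -> m < 2 ->
  cost m.+1 x b <= cost m x a + 2 * sq a b.
Proof.
move=> xs As bs; case: m => [|[|]] //= _.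
  by case: eqP => [->|_] /=; [lia | have := sq_lt xs bs; lia].
by have := sq_parallelogram x a b; lia.
Qed.

Lemma cost_le m a b : a < s -> b < s -> cost m a b <= 2 * (s * s).
Proof.
by move=> As bs; have := sq_lt As bs; case: m => [|[|m]] /=; first case: (a != b); lia.
Qed.

Lemma cost_split m x w z : x < s -> w < s -> z < s -> m <= 2 ->
  sq x z <= cost m x w + cost (2 - m) w z.
Proof.
move=> xs ws zs; have lt := sq_lt xs zs; case: m => [|[|[|]]] //= _.
- by case: eqP => [->|_] /=; lia.
- by have := sq_parallelogram x w z; lia.
- by case: eqP => [->|_] /=; lia.
Qed.

(** For [m = 1] the excess in the parallelogram identity must vanish. Otherwise one side allows no
    change, and its penalty alone would exceed [sq x z]. *)
Lemma cost_tight m x w z : x < s -> w < s -> z < s -> m <= 2 ->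
  cost m x w + cost (2 - m) w z = sq x z ->
  [/\ m = 0 -> w = x, m = 1 -> x + z = 2 * w & m = 2 -> w = z].
Proof.
move=> xs ws zs; have lt := sq_lt xs zs; case: m => [|[|[|]]] //= _ E.
- by split=> // _; move: E; case: eqP => [->|_] /=; lia.
- by split=> // _; apply: sq_eq0; have := sq_parallelogram x w z; lia.
- by split=> // _; move: E; case: eqP => [->|_] /=; lia.
Qed.

End Costs.

Arguments cost : simpl never.

(** * The layered lattice of dimension [l.+1] and side [s] *)

Section Lattice.
Variables l r : nat.

Local Notation s := (2 * r).+1.
Local Notation vec := {ffun 'I_l.+1 -> 'I_s}.

(* A node is a level, a vector, and a position on the path replacing that point:
   (false, a) is the entry port from the vector whose changed coordinate was a,
   (true, b) the exit port towards the vector whose changed coordinate is b. *)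
Definition node : predArgType := ('I_(2 * l.+1).+1 * vec * (bool * 'I_s))%type.

Implicit Types (u : node) (x z v : vec) (i : nat) (k : 'I_l.+1).

Definition pos (p : bool * 'I_s) : nat := p.1 * s + p.2.

Definition trunk : rel node := fun u u' => (u'.1 == u.1) && (pos u'.2 == (pos u.2).+1).

Definition coord i : 'I_l.+1 := inord (if i <= l then i else i - l.+1).

Definition exit : pred node := fun u => u.2.1 && (u.1.1 < 2 * l.+1).

Definition update v k (a : 'I_s) : vec := [ffun q => if q == k then a else v q].

(** The entry port is indexed by the overwritten value, so the edge can be traced back; this is why
    [entry] is injective on exit ports. *)
Definition entry u : node :=
  (inord u.1.1.+1, update u.1.2 (coord u.1.1) u.2.2, (false, u.1.2 (coord u.1.1))).

(** Large enough that [2 * base] exceeds the maximal cost [2 * (s * s)] plus twice a port index,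
    which keeps the potentials Lipschitz when an edge goes against their growth. *)
Definition base : nat := s * s + s.

(* The term a - b offsets the lengths s + b and a walked along the two port
   paths, so that the total length depends on a and b only through sq a b. *)
Definition span u : nat :=
  let a : nat := u.1.2 (coord u.1.1) in let b : nat := u.2.2 in
  base + a - b + 2 * sq a b.

Definition width : nat := 5 * (s * s).

Lemma pos_lt p : pos p < 2 * s.
Proof. by case: p => [[] a]; rewrite /pos /=; have := ltn_ord a; lia. Qed.

Lemma pos_inj : injective pos.
Proof.
move=> [b a] [b' a']; rewrite /pos /= => E; have := ltn_ord a; have := ltn_ord a'.
by case: b b' E => [] [] /=; rewrite ?(mul1n, mul0n) => E lt lt';
  try (by congr pair; apply: val_inj; rewrite /=; lia); exfalso; lia.
Qed.

Lemma span_gt1 u : 1 < span u.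
Proof. by rewrite /span /base; have := ltn_ord u.2.2; nia. Qed.

Lemma span_width u : span u <= width.
Proof.
rewrite /span /width /base.
by have := sq_lt (ltn_ord (u.1.2 (coord u.1.1))) (ltn_ord u.2.2);
   have := ltn_ord (u.1.2 (coord u.1.1)); nia.
Qed.

Lemma trunk_irr : irreflexive trunk.
Proof. by move=> u; rewrite /trunk eqxx /=; apply/eqP; lia. Qed.

Lemma trunk_fun (u v w : node) : trunk u v -> trunk u w -> v = w.
Proof.
case: u v w => [u p] [v q] [w t]; rewrite /trunk /=.
by move=> /andP[/eqP-> /eqP pq] /andP[/eqP-> /eqP pt]; congr pair; apply: pos_inj; rewrite pq.
Qed.

Lemma trunk_inj (u v w : node) : trunk v u -> trunk w u -> v = w.
Proof.
case: u v w => [u p] [v q] [w t]; rewrite /trunk /=.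
move=> /andP[/eqP-> /eqP pq] /andP[/eqP-> /eqP pt]; congr pair; apply: pos_inj.
by apply: succn_inj; rewrite -pq.
Qed.

Lemma exit_entry u : exit u -> ~~ exit (entry u).
Proof. by []. Qed.

Lemma entry_inj : {in exit &, injective entry}.
Proof.
move=> [[i v] [b a]] [[j w] [c d]]; rewrite !unfold_in /exit /= => /andP[-> li] /andP[-> lj].
case=> /(congr1 val); rewrite /= !inordK ?ltnS // => -[/val_inj ij]; subst j.
move=> vw E; have ad : a = d by move/ffunP: vw => /(_ (coord i)); rewrite !ffunE eqxx.
congr (_, _, (_, _)) => //; apply/ffunP=> q; move/ffunP: vw => /(_ q); rewrite !ffunE.
by case: eqP => // -> _; apply: val_inj; rewrite /= E.
Qed.

(** Coordinate [k] is changed by the steps out of levels [k] and [l.+1 + k]; this counts those below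
    level [i]. *)
Definition changes i k : nat := (k < i) + (l.+1 + k < i).

Lemma changes_le i k : changes i k <= 2.
Proof. by rewrite /changes; lia. Qed.

Lemma coordE i k : i < 2 * l.+1 -> (k == coord i) = (if i <= l then k == i :> nat else k + l.+1 == i :> nat).
Proof.
move=> li; rewrite -val_eqE /= inordK; last by case: ifP; lia.
by case: ifP => // il; lia.
Qed.

Lemma changesS i k : i < 2 * l.+1 -> changes i.+1 k = changes i k + (k == coord i).
Proof. by move=> li; rewrite coordE // /changes; have := ltn_ord k; case: ifP; lia. Qed.

Lemma changes_coord i : i < 2 * l.+1 -> changes i (coord i) < 2.
Proof. by move=> li; have := changesS (coord i) li; have := changes_le i.+1 (coord i); rewrite eqxx; lia. Qed.

(** A lower bound for the distance from the first vertex of [x] at level 0; [psi] is its mirror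
    image, for the last vertex of [z] at the top level. Each level contributes [base + s], and each
    coordinate the least price of its displacement with the changes available. *)
Definition phi x u : nat :=
  u.1.1 * (base + s) + pos u.2 + \sum_k cost s (changes u.1.1 k) (x k) (u.1.2 k).

Definition psi z u : nat :=
  (2 * l.+1 - u.1.1) * (base + s) + ((2 * s - 1) - pos u.2)
  + \sum_k cost s (2 - changes u.1.1 k) (u.1.2 k) (z k).

Definition opt x z : nat :=
  2 * l.+1 * (base + s) + (2 * s - 1) + \sum_k sq (x k) (z k).

(** * Lipschitz bounds and tightness of the potentials *)

Lemma phi_trunk x (u v : node) : trunk u v -> phi x v <= (phi x u).+1 /\ phi x u <= (phi x v).+1.
Proof. by case: u v => [u p] [v q] /andP[/= /eqP-> /eqP]; rewrite /phi /= => ->; lia. Qed.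

Lemma psi_trunk z (u v : node) : trunk u v -> psi z v <= (psi z u).+1 /\ psi z u <= (psi z v).+1.
Proof. by case: u v => [u p] [v q] /andP[/= /eqP-> /eqP]; rewrite /psi /= => ->; lia. Qed.

(** Crossing an edge affects a single summand; [F] is arbitrary so as to serve both [phi] and
    [psi]. *)
Lemma sum_update (F : nat -> 'I_l.+1 -> nat -> nat) v i (a : 'I_s) : i < 2 * l.+1 ->
  exists rest,
    \sum_k F (changes i k) k (v k) = F (changes i (coord i)) (coord i) (v (coord i)) + rest /\
    \sum_k F (changes i.+1 k) k (update v (coord i) a k)
      = F (changes i (coord i)).+1 (coord i) a + rest.
Proof.
move=> li; exists (\sum_(k | k != coord i) F (changes i k) k (v k)).
split; first by rewrite (bigD1 (coord i)).
rewrite (bigD1 (coord i)) //= changesS // eqxx ffunE eqxx addn1.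
congr (_ + _); apply: eq_bigr => k /negbTE nk.
by rewrite changesS // nk addn0 ffunE nk.
Qed.

Lemma exit_level u : exit u -> u.1.1 < 2 * l.+1 /\ pos u.2 = s + u.2.2.
Proof. by case: u => [[i v] [[] a]] //= /andP[_ lt]; rewrite /pos mul1n. Qed.

(** The first inequality reduces to [cost_step], the second to [cost_le] and the size of [base]. For
    [psi] the two roles are exchanged. *)
Lemma phi_entry x u : exit u ->
  phi x (entry u) <= phi x u + span u /\ phi x u <= phi x (entry u) + span u.
Proof.
move=> /exit_level[li pE].
have [rest []] := sum_update (fun m k => cost s m (x k)) u.1.2 u.2.2 li.
rewrite /phi /entry /= inordK ?ltnS // => -> ->.
rewrite pE /span /pos /=.
set a := u.1.2 _; set b := u.2.2; set m := changes _ _; set y := x _.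
have := cost_step (ltn_ord y) (ltn_ord a) (ltn_ord b) (changes_coord li).
have := cost_le m (ltn_ord y) (ltn_ord a).
have bE : base = s * s + s by [].
rewrite -/m (mulSn _ (base + s)); have := ltn_ord a; have := ltn_ord b; move: base bE => B bE.
by move: (s * s) bE => ss -> lb la lc ls; split; lia.
Qed.

Lemma psi_entry z u : exit u ->
  psi z (entry u) <= psi z u + span u /\ psi z u <= psi z (entry u) + span u.
Proof.
move=> /exit_level[li pE].
have [rest []] := sum_update (fun m k c => cost s (2 - m) c (z k)) u.1.2 u.2.2 li.
rewrite /psi /entry /= inordK ?ltnS // => -> ->.
rewrite pE /span /pos /=.
have lm := changes_coord li.
set a := u.1.2 _; set b := u.2.2; set m := changes _ _ in lm *; set y := z _.
have m2 : 2 - m.+1 < 2 by lia.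
have := cost_step (ltn_ord y) (ltn_ord b) (ltn_ord a) m2.
have -> : (2 - m.+1).+1 = 2 - m by lia.
rewrite (costC _ _ y a) (costC _ _ y b) (sqC b a).
have := cost_le (2 - m.+1) (ltn_ord b) (ltn_ord y).
have -> : 2 * l.+1 - u.1.1 = (2 * l.+1 - u.1.1.+1).+1 by lia.
have bE : base = s * s + s by [].
rewrite (mulSn _ (base + s)); have := ltn_ord a; have := ltn_ord b; move: base bE => B bE.
by move: (s * s) bE => ss -> lb la lc ls; split; lia.
Qed.

Lemma phi_psi_sum x z u : phi x u + psi z u = 2 * l.+1 * (base + s) + (2 * s - 1) +
  \sum_k (cost s (changes u.1.1 k) (x k) (u.1.2 k) + cost s (2 - changes u.1.1 k) (u.1.2 k) (z k)).
Proof.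
rewrite /phi /psi big_split /=; have := pos_lt u.2; have := ltn_ord u.1.1; rewrite ltnS => li lp.
by have := mulnDl u.1.1 (2 * l.+1 - u.1.1) (base + s); rewrite subnKC //; lia.
Qed.

Lemma opt_le x z u : opt x z <= phi x u + psi z u.
Proof.
rewrite phi_psi_sum /opt leq_add2l; apply: leq_sum => k _.
by apply: cost_split (changes_le _ _); apply: ltn_ord.
Qed.

(** The bound [cost_split] holds in each coordinate, so a tight sum makes every summand tight and
    [cost_tight] applies. *)
Lemma opt_tight x z u : phi x u + psi z u <= opt x z ->
  forall k, [/\ changes u.1.1 k = 0 -> u.1.2 k = x k, changes u.1.1 k = 1 -> x k + z k = 2 * u.1.2 k
    & changes u.1.1 k = 2 -> u.1.2 k = z k].
Proof.
rewrite phi_psi_sum /opt leq_add2l => le k.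
have split_q q : sq (x q) (z q) <= cost s (changes u.1.1 q) (x q) (u.1.2 q)
    + cost s (2 - changes u.1.1 q) (u.1.2 q) (z q).
  by apply: cost_split (changes_le _ _); apply: ltn_ord.
have E : cost s (changes u.1.1 k) (x k) (u.1.2 k) + cost s (2 - changes u.1.1 k) (u.1.2 k) (z k)
    = sq (x k) (z k).
  apply/eqP; rewrite eqn_leq split_q andbT; move: le.
  rewrite [X in X <= _ -> _](bigD1 k) //= [X in _ <= X -> _](bigD1 k) //=.
  set X := \sum_(_ | _) _; set Y := \sum_(_ | _) _ => le.
  suff : Y <= X by lia.
  exact: leq_sum.
have [h0 h1 h2] := cost_tight (ltn_ord _) (ltn_ord _) (ltn_ord _) (changes_le _ _) E.
by split=> [/h0/val_inj|//|/h2/val_inj].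
Qed.

(** * The graph and its shortest walks *)

Lemma width_gt0 : 0 < width. Proof. by []. Qed.

Definition root : 'I_width := Ordinal width_gt0.

Definition grid : rel 'I_#|{: node * 'I_width}| := sdg trunk exit entry span (M := width).

Definition at_root u : 'I_#|{: node * 'I_width}| := enum_rank (u, root).

Lemma pos_pred q : 0 < pos q -> exists p, pos q = (pos p).+1.
Proof.
case: q => b a; rewrite /pos /=; have := ltn_ord a; case: (posnP a) => [-> |a_gt0] la qp.
  by exists (false, ord_max); move: qp; case: b => //=; lia.
exists (b, inord a.-1); rewrite /= inordK; lia.
Qed.

Lemma walk_trunk w p q : pos p <= pos q ->
  walk grid (pos q - pos p) (at_root (w, p)) (at_root (w, q)).
Proof.
move=> /subnKC; move: (pos q - pos p) => d; elim: d q => [|d IH] q pq.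
  by have -> : q = p; [apply: pos_inj; rewrite -pq addn0 | apply: eqxx].
have [t qt] : exists t, pos q = (pos t).+1 by apply: pos_pred; rewrite -pq addnS.
rewrite -(addn1 d); apply: walk_cat (IH t _) _; first by move: pq; rewrite qt; lia.
by apply: walk_arc; rewrite /arc /trunk /= qt !eqxx.
Qed.

Lemma walk_span u : exit u -> walk grid (span u) (at_root u) (at_root (entry u)).
Proof. by apply: walk_hair => //; [apply: span_gt1 | apply: span_width]. Qed.

Implicit Types X Z : {ffun 'I_l.+1 -> 'I_r}.

(** Doubled coordinates make the midpoint [X k + Z k] integral. *)
Definition even X : vec := [ffun k => inord (2 * X k)].

Definition stage X Z i : vec := [ffun k => match changes i k with
  0 => inord (2 * X k) | 1 => inord (X k + Z k) | _ => inord (2 * Z k) end].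

Lemma evenE X k : even X k = 2 * X k :> nat.
Proof. by rewrite ffunE inordK //; have := ltn_ord (X k); lia. Qed.

Lemma even_inj : injective even.
Proof.
move=> X Z E; apply/ffunP=> k; apply: val_inj => /=.
by have := evenE X k; rewrite E evenE; lia.
Qed.

Lemma stageE X Z i k :
  stage X Z i k = match changes i k with 0 => 2 * X k | 1 => X k + Z k | _ => 2 * Z k end :> nat.
Proof.
rewrite ffunE; have := ltn_ord (X k); have := ltn_ord (Z k).
by case: (changes i k) => [|[|m]] ? ?; rewrite inordK //; lia.
Qed.

Lemma stage0 X Z : stage X Z 0 = even X.
Proof. by apply/ffunP=> k; rewrite !ffunE. Qed.

Lemma stage_last X Z : stage X Z (2 * l.+1) = even Z.
Proof.
apply/ffunP=> k; rewrite !ffunE; have -> // : changes (2 * l.+1) k = 2.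
by rewrite /changes; have := ltn_ord k; lia.
Qed.

Lemma stageS X Z i : i < 2 * l.+1 ->
  update (stage X Z i) (coord i) (stage X Z i.+1 (coord i)) = stage X Z i.+1.
Proof.
move=> li; apply/ffunP=> k; rewrite ffunE; case: eqP => [-> //|/eqP/negbTE nk].
by rewrite !ffunE changesS // nk addn0.
Qed.

Definition source X : node := (ord0, even X, (false, ord0)).

Definition sink Z : node := (ord_max, even Z, (true, ord_max)).

Lemma phi_source X : phi (even X) (source X) = 0.
Proof. by rewrite /phi /pos /= big1 // => k _; apply: costxx. Qed.

Lemma psi_sink Z : psi (even Z) (sink Z) = 0.
Proof.
rewrite /psi /pos /= big1 ?subnn ?addn0 /=; first by lia.
by move=> k _; apply: costxx.
Qed.

Lemma phi_sink X Z : phi (even X) (sink Z) = opt (even X) (even Z).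
Proof.
rewrite /phi /opt /pos /=; congr (_ + _ + _); first by lia.
apply: eq_bigr => k _; have -> // : changes (2 * l.+1) k = 2.
by rewrite /changes; have := ltn_ord k; lia.
Qed.

(** Along the midpoint route the potential [phi] is attained, so it is the true distance there. *)
Lemma walk_stage X Z i : i <= 2 * l.+1 -> exists a : 'I_s,
  walk grid (phi (even X) (inord i, stage X Z i, (false, a)))
    (at_root (source X)) (at_root (inord i, stage X Z i, (false, a))).
Proof.
elim: i => [|i IH] li.
  exists ord0; rewrite stage0.
  have -> : (inord 0, even X, (false, ord0)) = source X.
    by congr (_, _, _); apply: val_inj; rewrite /= inordK.
  by rewrite phi_source; apply: eqxx.
have [a Wa] := IH (ltnW li).
exists (stage X Z i (coord i)).
set u : node := (inord i, stage X Z i, (true, stage X Z i.+1 (coord i))).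
have iE : (inord i : 'I_(2 * l.+1).+1) = i :> nat by rewrite inordK // ltnW.
have exu : exit u by rewrite /exit /= iE.
have eE : entry u = (inord i.+1, stage X Z i.+1, (false, stage X Z i (coord i))).
  by rewrite /entry /= iE stageS.
rewrite -eE; suff -> : phi (even X) (entry u) = phi (even X) (inord i, stage X Z i, (false, a))
    + (pos u.2 - pos (false, a)) + span u.
  apply: walk_cat (walk_span exu); apply: walk_cat Wa _; apply: walk_trunk.
  by rewrite /pos /=; have := ltn_ord a; lia.
have [rest []] := sum_update (fun m k => cost s m (even X k)) (stage X Z i) (stage X Z i.+1 (coord i)) li.
rewrite /phi eE /span /= iE inordK ?ltnS // stageS // => -> ->.
(* Equality in [cost_step], because both changes of a coordinate cover half of the difference. *)
have step : cost s (changes i (coord i)).+1 (even X (coord i)) (stage X Z i.+1 (coord i)) =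
    cost s (changes i (coord i)) (even X (coord i)) (stage X Z i (coord i))
    + 2 * sq (stage X Z i (coord i)) (stage X Z i.+1 (coord i)).
  rewrite !stageE changesS // eqxx addn1 evenE; have := changes_coord li.
  case: (changes i (coord i)) => [|[|]] //= _; first by rewrite costxx.
  by rewrite /cost sq_double sq_double_mid sq_mid_double; lia.
rewrite step (mulSn _ (base + s)) /pos /=.
have bE : base = s * s + s by [].
have := ltn_ord (stage X Z i.+1 (coord i)); have := ltn_ord a.
move: base bE => B bE; move: (s * s) bE => ss ->; lia.
Qed.

Lemma walk_opt X Z : walk grid (opt (even X) (even Z)) (at_root (source X)) (at_root (sink Z)).
Proof.
have [a Wa] := walk_stage X Z (leqnn _).
have mE : inord (2 * l.+1) = ord_max :> 'I_(2 * l.+1).+1 by apply: val_inj; rewrite /= inordK.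
move: Wa; rewrite stage_last mE => Wa; rewrite -phi_sink.
have -> : phi (even X) (sink Z) = phi (even X) (ord_max, even Z, (false, a)) + (pos (true, ord_max) - pos (false, a)).
  by rewrite /phi /sink /pos /=; have := ltn_ord a; lia.
by apply: walk_cat Wa (walk_trunk _ _); rewrite /pos /=; have := ltn_ord a; lia.
Qed.

(** * Degrees, and the count of hubs *)

Lemma grid_simple : simple_graph grid.
Proof. apply: sdg_simple trunk_irr; exact: span_gt1. Qed.

Lemma grid_max_degree : 0 < r -> max_degree3 grid.
Proof.
move=> r_gt0; split.
  by apply: sdg_degree; [exact: span_gt1 | exact: trunk_fun | exact: trunk_inj | exact: entry_inj | exact: exit_entry].
pose w : 'I_(2 * l.+1).+1 * vec := (ord0, [ffun => ord0]).
have b1 : 1 < width by rewrite /width; lia.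
(* Exit port 0 at level 0 has the last entry port before it, exit port 1 after it, and its own
   subdivided edge. *)
apply: (@sdg_degree3 _ _ _ _ _ _ span_gt1 trunk_fun trunk_inj entry_inj exit_entry
  (w, (true, ord0)) (w, (false, ord_max)) (w, (true, inord 1)) root (Ordinal b1)) => //.
- exact: trunk_irr.
- by rewrite /trunk eqxx /pos /=; apply/eqP; lia.
- by rewrite /trunk eqxx /pos /= inordK; apply/eqP; lia.
- by rewrite !xpair_eqE andbF.
- by rewrite /span /w /= ffunE /base /=; lia.
Qed.

(** The two distances at a common hub add up to at most [opt], so the extended potentials are tight
    there. The hub may be an inner point of an edge; [spread_tight] passes to the node that owns
    it. *)
Lemma hub_tight S X Z : hub_labeling grid S -> exists w,
  [&& w \in S (at_root (source X)), w \in S (at_root (sink Z)) &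
   phi (even X) (enum_val w).1 + psi (even Z) (enum_val w).1 <= opt (even X) (even Z)].
Proof.
move=> hubS; have [d dist_d d_le] := walk_dist (walk_opt X Z).
have [w [wX wZ [d1 [d2 [[Wd1 _] [Wd2 _] dE]]]]] := hubS _ _ _ dist_d.
exists w; rewrite wX wZ /=.
have [phi_le _] := sdg_lipschitz (@phi_trunk (even X)) (@phi_entry (even X)) Wd1.
have [_ psi_le] := sdg_lipschitz (@psi_trunk (even Z)) (@psi_entry (even Z)) Wd2.
apply: (@spread_tight _ exit entry span width).
- by move=> u exu; split; [case: (phi_entry (even X) exu) | case: (psi_entry (even Z) exu)].
- exact: opt_le.
move: phi_le psi_le; rewrite !enum_rankK !spread0 //; try exact: phi_entry; try exact: psi_entry.
by rewrite phi_source psi_sink !add0n => le1 le2; rewrite (leq_trans (leq_add le1 le2)) ?dE.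
Qed.

Lemma hub_total_size S : hub_labeling grid S -> r ^ (2 * l.+1) <= total_size S.
Proof.
move=> hubS; pose h p := xchoose (hub_tight p.1 p.2 hubS).
(* From level [l.+1] on every coordinate has changed at least once, so the hub and [X] determine
   [Z]; up to level [l] none has changed twice, so the hub and [Z] determine [X]. *)
pose late p := l < (enum_val (h p)).1.1.1.
pose F p := (at_root (if late p then source p.1 else sink p.2), h p).
have F_inj : injective F.
  move=> [X Z] [X' Z'] [E hE]; move: E; rewrite /late hE.
  have /and3P[_ _ /opt_tight T] := xchooseP (hub_tight X Z hubS).
  have /and3P[_ _ /opt_tight T'] := xchooseP (hub_tight X' Z' hubS).
  rewrite -/(h (X, Z)) hE in T; rewrite -/(h (X', Z')) in T'.
  set u := (enum_val _).1 in T T' *.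
  case: ifP => lu /enum_rank_inj [/even_inj E]; subst; congr pair; apply: even_inj; apply/ffunP=> k.
    have : 0 < changes u.1.1 k by rewrite /changes; have := ltn_ord k; lia.
    have := changes_le u.1.1 k; have [_ T1 T2] := T k; have [_ T1' T2'] := T' k.
    case: (changes _ _) T1 T2 T1' T2' => [|[|[|]]] // T1 T2 T1' T2' _ _; last by rewrite -T2 // T2'.
    by apply: val_inj => /=; have := T1 erefl; have := T1' erefl; lia.
  have : changes u.1.1 k < 2 by rewrite /changes; have := ltn_ord k; lia.
  have [T0 T1 _] := T k; have [T0' T1' _] := T' k.
  case: (changes _ _) T0 T1 T0' T1' => [|[|]] // T0 T1 T0' T1' _; first by rewrite -T0 // T0'.
  by apply: val_inj => /=; have := T1 erefl; have := T1' erefl; lia.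
have -> : r ^ (2 * l.+1) = #|{: {ffun 'I_l.+1 -> 'I_r} * {ffun 'I_l.+1 -> 'I_r}}|.
  by rewrite card_prod !card_ffun !card_ord -expnD addnn mul2n.
rewrite total_size_card -(card_imset _ F_inj); apply/subset_leq_card/subsetP=> _ /imsetP[p _ ->].
rewrite inE /=; have /and3P[] := xchooseP (hub_tight p.1 p.2 hubS).
by case: ifP.
Qed.

Lemma card_node : #|{: node * 'I_width}| = (2 * l.+1).+1 * s ^ l.+1 * (2 * s) * width.
Proof. by rewrite !card_prod card_ffun card_bool !card_ord. Qed.

End Lattice.

(** * Size estimates *)

Lemma card_node_bounds l (c := l.+1) :
  2 ^ (c * c) <= #|{: node l (2 ^ c) * 'I_(width (2 ^ c))}| <= 2 ^ (c * c + 6 * c + 11).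
Proof.
rewrite card_node /width -/c; set s := (2 * 2 ^ c).+1.
have s_ge : 2 ^ c <= s by rewrite /s; lia.
have s_le : s <= 2 ^ (c + 2) by rewrite /s expnD; have : 0 < 2 ^ c by [rewrite expn_gt0]; lia.
have s_gt0 : 0 < s by [].
apply/andP; split.
  rewrite expnM; apply: (@leq_trans (s ^ c)); first by rewrite leq_exp2r.
  by rewrite -!mulnA mulnCA leq_pmulr // !muln_gt0.
(* Uses [2 * c + 1 <= 2 ^ c.+1], [s <= 2 ^ (c + 2)] and [5 <= 2 ^ 3]; the exponents add up to
   [c * c + 6 * c + 11]. *)
apply: (@leq_trans (2 ^ c.+1 * (2 ^ (c + 2)) ^ c * (2 * 2 ^ (c + 2)) * (2 ^ 3 * (2 ^ (c + 2) * 2 ^ (c + 2))))).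
  do ![apply: leq_mul => //]; last by rewrite leq_exp2r.
  by rewrite expnS; have := ltn_expl c (ltnSn 1); lia.
by rewrite -expnM -!expnS -!expnD leq_exp2l //; lia.
Qed.

(* Passage to real numbers *)
From Stdlib Require Import Reals Lra.
Open Scope R_scope.

Lemma INR_exp2 k : INR (expn 2 k) = 2 ^ k.
Proof. by elim: k => // k IH; rewrite expnS mult_INR IH. Qed.

Lemma INR_leq m n : leq m n -> INR m <= INR n.
Proof. by move=> mn; apply: le_INR; apply/leP. Qed.

(** Here [n ^ 2 / t] is at most [2 ^ (12 * c + 22)], and [12 * c + 22 <= 34 * c]. Since
    [ln 2 > 1/2], [c <= 2 * sqrt (ln n)], whence the constant 68. *)
Lemma ratio_bound (c n t : nat) : leq 1 c -> leq (expn 2 (c * c)) n ->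
  leq n (expn 2 (c * c + 6 * c + 11)) -> leq (expn 2 (2 * (c * c))) t ->
  INR t / INR n >= INR n / Rpower 2 (68 * sqrt (ln (INR n))).
Proof.
move=> /INR_leq c_gt0 /INR_leq n_ge /INR_leq n_le /INR_leq t_ge.
move: n_ge n_le t_ge; rewrite !INR_exp2 => n_ge n_le t_ge.
have n_gt0 : 0 < INR n by apply: Rlt_le_trans n_ge; apply: pow_lt; lra.
have c_le : 1 <= INR c by move: c_gt0; rewrite /=.
have ln_ge : (INR c / 2) * (INR c / 2) <= ln (INR n).
  apply: (Rle_trans _ (ln (2 ^ (c * c)))); last first.
    by case: n_ge => [lt|->]; [left; apply: ln_increasing lt; apply: pow_lt; lra | right].
  rewrite ln_pow ?mult_INR; last by lra.
  by have := ln_lt_2; nra.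
have sqrt_ge : INR c / 2 <= sqrt (ln (INR n)).
  by rewrite -(sqrt_square (INR c / 2)); [apply: sqrt_le_1_alt | lra].
have pow_ge : 2 ^ (12 * c + 22) <= Rpower 2 (68 * sqrt (ln (INR n))).
  rewrite -Rpower_pow; last by lra.
  apply: Rle_Rpower; first by lra.
  have -> : INR (12 * c + 22) = 12 * INR c + 22.
    by rewrite plus_INR mult_INR !(INR_IZR_INZ (S _)).
  lra.
set P := Rpower 2 _ in pow_ge *.
have P_gt0 : 0 < P by apply: exp_pos.
apply: Rle_ge; apply: (Rmult_le_reg_r (INR n * P)); first by nra.
have -> : INR n / P * (INR n * P) = INR n * INR n by field; lra.
have -> : INR t / INR n * (INR n * P) = INR t * P by field; lra.
apply: (Rle_trans _ (2 ^ (c * c + 6 * c + 11) * 2 ^ (c * c + 6 * c + 11))).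
  by apply: Rmult_le_compat; lra.
rewrite -pow_add (_ : (_ + _)%coq_nat = (2 * (c * c) + (12 * c + 22))%coq_nat); last by lia.
rewrite pow_add; apply: Rmult_le_compat => //; apply: pow_le; lra.
Qed.

Theorem theorem1 :
  exists C : R, 0 < C /\
    forall N : nat, exists n : nat, (N <= n)%coq_nat /\ (0 < n)%coq_nat /\
      exists e : rel 'I_n, simple_graph e /\ max_degree3 e /\
        forall S : 'I_n -> {set 'I_n}, hub_labeling e S ->
          INR (total_size S) / INR n >= INR n / Rpower 2 (C * sqrt (ln (INR n))).
Proof.
exists 68; split; first by lra.
move=> N; have /andP[n_ge n_le] := card_node_bounds N.
(* Dimension [c = N.+1] and [r = 2 ^ c] give [r ^ (2 * c) = 2 ^ (2 * (c * c))] pairs of end points,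
   and at least [2 ^ (c * c) > N] vertices. *)
exists #|{: node N (expn 2 N.+1) * 'I_(width (expn 2 N.+1))}|.
have N_lt : leq N.+1 #|{: node N (expn 2 N.+1) * 'I_(width (expn 2 N.+1))}|.
  apply: leq_trans n_ge; apply: leq_trans (ltnW (ltn_expl N.+1 (ltnSn 1))) _.
  by rewrite leq_exp2l // leq_pmulr.
split; first by apply/leP; apply: ltnW.
split; first by apply/ltP; apply: leq_trans N_lt.
exists (grid (l := N) (r := expn 2 N.+1)); split; first exact: grid_simple.
split; first by apply: grid_max_degree; rewrite expn_gt0.
move=> S hubS; apply: (@ratio_bound N.+1) => //.
by apply: leq_trans (hub_total_size hubS); rewrite -expnM mulnCA.
Qed.
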